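(* Let $\mathbb{X}$ be a finite-dimensional real Banach space. If $\Gamma(\mathbb{X}) < \frac{1}{2}$, then $\mathbb{X}$ is uniformly non-square.
   Context: All normed spaces are real, and $S_\mathbb{X}=\{x\in\mathbb{X}:\|x\|=1\}$. Birkhoff-James orthogonality: $x\perp_B y$ means $\|x+\lambda y\|\ge\|x\|$ for all $\lambda\in\mathbb{R}$. Norm derivatives: $\rho'_{\pm}(x,y)=\|x\|\lim_{t\to 0^{\pm}}\frac{\|x+ty\|-\|x\|}{t}$ and $\rho'(x,y)=\frac12(\rho'_+(x,y)+\rho'_-(x,y))$. The constant $\Gamma(\mathbb{X})$ is defined by $\Gamma(\mathbb{X})=\sup\{|\rho'(x,y)|: x,y\in S_\mathbb{X},\ x\perp_B y\}$. The space $\mathbb{X}$ is uniformly non-square if $\sup_{x,y\in S_\mathbb{X}}\min\{\|x-y\|,\|x+y\|\}<2$. *)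

(* Defs.v *)
From mathcomp Require Import all_boot all_order all_algebra.
From mathcomp Require Import all_classical all_reals all_analysis.

Set Implicit Arguments.
Unset Strict Implicit.
Unset Printing Implicit Defensive.

Import Order.TTheory GRing.Theory Num.Theory.
Import numFieldNormedType.Exports.

Local Open Scope classical_set_scope.
Local Open Scope ring_scope.

Definition finite_dimensional (R : realType) (X : lmodType R) : Prop :=
  exists (n : nat) (e : 'I_n -> X),
    forall x : X, exists c : 'I_n -> R, x = \sum_(i < n) c i *: e i.

Definition unit_sphere (R : realType) (X : normedModType R) : set X :=
  [set x : X | `|x| = 1].
Arguments unit_sphere {R} X _.

Definition BJ_orthogonal (R : realType) (X : normedModType R) (x y : X) : Prop :=
  forall a : R, `|x| <= `|x + a *: y|.

(* The difference quotient is nondecreasing in [t] (by convexity of the norm)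
   and bounded by the norm of [y], so both one-sided limits below exist and
   [lim] is never applied to a divergent filter. *)
Definition norm_quotient (R : realType) (X : normedModType R) (x y : X) (t : R) : R :=
  (`|x + t *: y| - `|x|) / t.

Definition rho_right (R : realType) (X : normedModType R) (x y : X) : R :=
  `|x| * lim (norm_quotient x y t @[t --> 0^'+]).

Definition rho_left (R : realType) (X : normedModType R) (x y : X) : R :=
  `|x| * lim (norm_quotient x y t @[t --> 0^'-]).

Definition rho (R : realType) (X : normedModType R) (x y : X) : R :=
  2^-1 * (rho_right x y + rho_left x y).

(* Suprema are taken in the extended reals, so no boundedness is presupposed;
   the supremum of the empty set (possible when dim X <= 1) is -oo. *)
Definition Gamma (R : realType) (X : normedModType R) : \bar R :=
  ereal_sup [set r : \bar R | exists x y : X,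
    [/\ unit_sphere X x, unit_sphere X y, BJ_orthogonal x y
      & r = `|rho x y|%:E]].

Definition uniformly_non_square (R : realType) (X : normedModType R) : Prop :=
  (ereal_sup [set r : \bar R | exists x y : X,
    [/\ unit_sphere X x, unit_sphere X y
      & r = (Num.min `|x - y| `|x + y|)%:E]] < 2%:E)%E.

Arguments Gamma {R} X.
Arguments uniformly_non_square {R} X.

(* Main.v *)
(* The unit sphere is compact, so the supremum defining uniform
   non-squareness is attained; were it at least 2, there would be unit vectors
   [x], [y] with [|x + y| = |x - y| = 2], hence spanning an isometric copy of
   the l1-plane. There [x] is Birkhoff-James orthogonal to the unit vector
   [v = (x + y)/2], since [|x + t v| = |1 + t/2| + |t/2|], and the right and
   left derivatives of the norm at [x] along [v] are 1 and 0. Thus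
   [rho x v = 1/2], which forces [Gamma X >= 1/2]. *)
Require Import Defs.
From mathcomp Require Import all_boot all_order all_algebra.
From mathcomp Require Import all_classical all_reals all_analysis.
From mathcomp Require Import ring lra.

Import Order.TTheory GRing.Theory Num.Theory.
Import numFieldNormedType.Exports.

Local Open Scope classical_set_scope.
Local Open Scope ring_scope.

Definition lincomb {R : realType} {X : lmodType R} {n : nat}
  (e : 'I_n -> X) (c : 'rV[R]_n) : X := \sum_(i < n) c ord0 i *: e i.

Lemma lincombZ {R : realType} {X : lmodType R} {n : nat} (e : 'I_n -> X) a c :
  lincomb e (a *: c) = a *: lincomb e c.
Proof.
by rewrite /lincomb scaler_sumr; apply: eq_bigr => i _; rewrite mxE scalerA.
Qed.

Lemma lincombB {R : realType} {X : lmodType R} {n : nat} (e : 'I_n -> X) c d :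
  lincomb e (c - d) = lincomb e c - lincomb e d.
Proof.
by rewrite /lincomb -sumrB; apply: eq_bigr => i _; rewrite !mxE scalerBl.
Qed.

(** A spanning family with a nontrivial relation stays spanning after one of its vectors is dropped;
    induction on its length ends at a free family. *)
Lemma finite_dimensional_basis {R : realType} {X : lmodType R} :
  finite_dimensional X ->
  exists (n : nat) (e : 'I_n -> X),
    (forall x, exists c, x = lincomb e c) /\
    (forall c, lincomb e c = 0 -> c = 0).
Proof.
move=> [n [e he]].
have {}he x : exists c, x = lincomb e c.
  have [c ->] := he x; exists (\row_i c i).
  by apply: eq_bigr => i _; rewrite mxE.
elim: n e he => [|n IHn] e he.
  by exists 0, e; split=> // c _; apply/rowP => -[].
have [free|/existsNP[c /not_implyP[c_rel /eqP c_neq0]]] :=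
  pselect (forall c, lincomb e c = 0 -> c = 0); first by exists n.+1, e.
have [j cj_neq0] : exists j, c ord0 j != 0.
  apply/existsP; apply: contraNT c_neq0; rewrite negb_exists => /forallP c0.
  by apply/eqP/rowP => i; rewrite mxE; apply/eqP; rewrite -[_ == _]negbK c0.
apply: (IHn (fun i => e (lift j i))) => x.
have [d ->] := he x.
(* Subtracting this multiple of the relation [c] leaves the vector unchanged and cancels its
   coefficient at [j], so [e j] is dispensable. *)
have -> : lincomb e d = lincomb e (d - (d ord0 j / c ord0 j) *: c).
  by rewrite lincombB lincombZ c_rel scaler0 subr0.
exists (\row_i (d - (d ord0 j / c ord0 j) *: c) ord0 (lift j i)).
rewrite /lincomb (bigD1_ord j) //= !mxE divfK // subrr scale0r add0r.
by apply: eq_bigr => i _; rewrite !mxE.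
Qed.

Lemma lincomb_continuous {R : realType} {X : normedModType R} {n : nat}
  (e : 'I_n -> X) : continuous (lincomb e).
Proof.
apply: continuous_big => [|i _]; first exact: add_continuous.
by move=> c; apply: continuousZr_tmp; exact: coord_continuous.
Qed.

Lemma norm_lincomb_continuous {R : realType} {X : normedModType R} {n : nat}
  (e : 'I_n -> X) : continuous (fun c => `|lincomb e c|).
Proof.
move=> c; apply: (continuous_comp (@lincomb_continuous _ _ _ e c)).
exact: norm_continuous.
Qed.

(** The norm of the combination attains a minimum on the compact unit sphere of coordinates.
    Freeness makes it positive, and homogeneity carries the bound to every [c]. *)
Lemma lincomb_bounded_below {R : realType} {X : normedModType R} {n : nat}
    (e : 'I_n -> X) : (forall c, lincomb e c = 0 -> c = 0) ->
  exists2 m : R, 0 < m & forall c, m * `|c| <= `|lincomb e c|.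
Proof.
move=> free.
pose S := [set c : 'rV[R]_n | `|c| = 1].
have compactS : compact S.
  apply: bounded_closed_compact.
    by exists 1; split=> // M M1 c /= ->; exact: ltW.
  have /continuous_closedP/(_ [set t | t = 1]) := @norm_continuous R 'rV[R]_n.
  by apply; exact: closed_eq.
have normalized c : c != 0 -> S (`|c|^-1 *: c).
  move=> c0; rewrite /S /= normrZ normfV normr_id mulVf //.
  by rewrite normr_eq0.
(* If [S] is empty, normalization shows that only [c = 0] exists, and any positive [m] works. *)
have [S0|/set0P/negP/negPn/eqP Sempty] := pselect (S !=set0); last first.
  exists 1 => // c; have [->|/normalized] := eqVneq c 0.
    by rewrite normr0 mulr0.
  by rewrite Sempty.
have [|c0 /set_mem c0S c0min] := compact_EVT_min S0 compactS
    (f := fun c => `|lincomb e c|).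
  by apply: continuous_subspaceT; exact: norm_lincomb_continuous.
exists `|lincomb e c0|.
  rewrite normr_gt0; apply: contra_eq_neq c0S => /free ->.
  by rewrite normr0 eq_sym oner_neq0.
move=> c; have [->|c_neq0] := eqVneq c 0.
  by rewrite normr0 mulr0.
have := c0min _ (mem_set (normalized c c_neq0)).
by rewrite lincombZ normrZ normfV normr_id mulrC ler_pdivlMr ?normr_gt0.
Qed.

(** The sphere is the continuous image of a coordinate set that is closed and, by the lower bound
    [m], bounded by [m^-1]. *)
Lemma finite_dimensional_compact_sphere {R : realType} {X : normedModType R} :
  finite_dimensional X -> compact (unit_sphere X).
Proof.
move=> /finite_dimensional_basis[n [e [span free]]].
have [m m0 hm] := lincomb_bounded_below e free.
pose K := [set c | `|lincomb e c| = 1].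
have -> : unit_sphere X = lincomb e @` K.
  apply/seteqP; split=> [x x1|_ [c c1 <-]] //.
  by have [c xE] := span x; exists c => //; rewrite /K /= -xE.
apply: continuous_compact.
  by apply: continuous_subspaceT; exact: lincomb_continuous.
apply: bounded_closed_compact.
  exists m^-1; split=> [|M mM c c1]; first exact: num_real.
  apply: le_trans (ltW mM); have := hm c.
  by rewrite c1 mulrC -ler_pdivlMr // div1r.
have /continuous_closedP/(_ [set t | t = 1]) := norm_lincomb_continuous e.
by apply; exact: closed_eq.
Qed.

Lemma normD_l1_ge0 {R : realType} {X : normedModType R} (x y : X) (a b : R) :
  `|x| = 1 -> `|y| = 1 -> `|x + y| = 2 -> 0 <= a -> 0 <= b ->
  `|a *: x + b *: y| = a + b.
Proof.
wlog le_ba : a b x y / b <= a => [hwlog x1 y1 xy a0 b0|x1 y1 xy a0 b0].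
  have [ba|/ltW ab] := leP b a; first exact: hwlog.
  by rewrite addrC (addrC a); apply: hwlog => //; rewrite addrC.
apply/eqP; rewrite eq_le; apply/andP; split.
  by rewrite (le_trans (ler_normD _ _)) // !normrZ x1 y1 !ger0_norm // !mulr1.
(* The reverse triangle inequality now gives at least [2 * a - (a - b) = a + b]. *)
have -> : a *: x + b *: y = a *: (x + y) - (a - b) *: y.
  by rewrite scalerDr scalerBl opprB -addrA [a *: y + _]addrC subrK.
apply: le_trans (lerB_dist _ _).
rewrite !normrZ xy y1 !ger0_norm ?subr_ge0 //; lra.
Qed.

(** Reduces to nonnegative coefficients: a global sign change makes [a] nonnegative, and the
    hypotheses are symmetric under replacing [y] by [- y]. *)
Lemma normD_l1 {R : realType} {X : normedModType R} (x y : X) (a b : R) :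
  `|x| = 1 -> `|y| = 1 -> `|x + y| = 2 -> `|x - y| = 2 ->
  `|a *: x + b *: y| = `|a| + `|b|.
Proof.
wlog a0 : a b / 0 <= a => [hwlog x1 y1 xy xNy|x1 y1 xy xNy].
  have [a0|/ltW a0] := leP 0 a; first exact: hwlog.
  rewrite -normrN opprD -!scaleNr hwlog ?oppr_ge0 //.
  by rewrite !normrN.
rewrite (ger0_norm a0).
have [b0|b0] := ger0P b; first exact: normD_l1_ge0.
rewrite -[b *: y]opprK -scaleNr -scalerN.
by apply: normD_l1_ge0; rewrite ?normrN ?oppr_ge0 // ltW.
Qed.

Lemma Gamma_ge_half {R : realType} {X : normedModType R} (x y : X) :
  `|x| = 1 -> `|y| = 1 -> `|x + y| = 2 -> `|x - y| = 2 ->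
  ((2^-1 : R)%:E <= Gamma X)%E.
Proof.
move=> x1 y1 xy xNy; pose v := 2^-1 *: (x + y).
have norm_xv t : `|x + t *: v| = `|1 + t / 2| + `|t / 2|.
  rewrite -(normD_l1 x y) //; congr `|_|.
  by rewrite scalerA scalerDr scalerDl scale1r addrA.
have right1 : rho_right x v = 1.
  rewrite /rho_right x1 mul1r; apply: lim_near_cst => //.
  near=> t; have t0 : 0 < t by near: t; exact: nbhs_right_gt.
  rewrite /norm_quotient norm_xv x1 !ger0_norm; try lra.
  by field; rewrite gt_eqF.
have left0 : rho_left x v = 0.
  rewrite /rho_left x1 mul1r; apply: lim_near_cst => //.
  near=> t; have t0 : t < 0 by near: t; exact: nbhs_left_lt.
  (* This keeps [1 + t / 2] positive, so that the norm is [(1 + t / 2) - t / 2 = 1] and the quotient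
     vanishes. *)
  have t2 : -2 < t by near: t; apply: nbhs_left_gt; lra.
  rewrite /norm_quotient norm_xv x1 ger0_norm ?ler0_norm; lra.
apply: ereal_sup_ubound; exists x, v; split => //.
- by rewrite /unit_sphere /= normrZ xy ger0_norm ?mulVf ?invr_ge0.
- move=> t; rewrite norm_xv x1.
  (* The two lower bounds [1 + t / 2] and [- (t / 2)] add up to [1]. *)
  have := ler_norm (1 + t / 2); have := ler_norm (- (t / 2)).
  by rewrite normrN; lra.
- by rewrite /rho right1 left0 addr0 mulr1 ger0_norm ?invr_ge0.
Unshelve. all: by end_near. Qed.

Theorem theorem2p6 (R : realType) (X : completeNormedModType R)
    (hfin : finite_dimensional X) (hGamma : (Gamma X < (2^-1 : R)%:E)%E) :
  uniformly_non_square X.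
Proof.
pose S := unit_sphere X.
pose f : X * X -> R :=
  (fun p => `|p.1 - p.2|) \min (fun p => `|p.1 + p.2|).
(* Attaining a maximum requires a nonempty sphere; over an empty one the supremum is [-oo], hence
   below [2]. *)
have [S0|Sempty] := pselect (S !=set0); last first.
  rewrite /uniformly_non_square (_ : [set r | _] = set0) ?ereal_sup0 ?ltNyr //.
  by apply/seteqP; split=> // r [x [_ [x1 _ _]]]; apply: Sempty; exists x.
have contf : continuous f.
  move=> p; apply: continuous_min; apply: cvg_norm.
    by apply: cvgB; [exact: cvg_fst|exact: cvg_snd].
  by apply: cvgD; [exact: cvg_fst|exact: cvg_snd].
have cS := finite_dimensional_compact_sphere hfin.
have SS0 : S `*` S !=set0 by have [x Sx] := S0; exists (x, x).
have [|[x y] /set_mem[/= x1 y1] fmax] :=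
    compact_EVT_max SS0 (compact_setX cS cS) (f := f).
  exact: continuous_subspaceT.
apply: (@le_lt_trans _ _ (f (x, y))%:E).
  apply: ge_ereal_sup => _ [u [w [u1 w1 ->]]]; rewrite lee_fin.
  by apply: (fmax (u, w)); exact: mem_set.
rewrite lte_fin ltNge; apply/negP; rewrite /f /= le_min => /andP[xNy xy].
have norm_le2 (z : X) : `|z| = 1 -> `|x + z| <= 2.
  by move=> z1; rewrite (le_trans (ler_normD _ _)) // x1 z1.
(* Both norms are at least [2] by assumption and at most [2] by the triangle inequality, hence equal
   to [2]. *)
have := lt_le_trans hGamma (Gamma_ge_half x y x1 y1 _ _).
by rewrite ltxx => H; apply: notF; apply: H; apply/eqP;
  rewrite eq_le norm_le2 ?normrN.
Qed.
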